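(* For every $1\le p<\infty$, the space $$\ell^p=\Big\{x=\{\alpha_n\}_{n=0}^{\infty}\subset\mathbb{C}:\ \|x\|_p^p=\sum_{n=0}^{\infty}|\alpha_n|^p<\infty\Big\}$$ is a Banach space with uniform multiplicity infinity of infinite index.
   Context: $\mathcal{B}(X)$ is the set of bounded linear operators on a complex Banach space $X$. A system of matrix units of $\mathcal{B}(X)$ is a family $\{u_{j,k}\}_{j,k=0}^{\infty}\subset\mathcal{B}(X)$ such that (a) $\sup\{\|u_{j,k}\|:j,k\ge 0\}<\infty$; (b) $u_{j,k}u_{l,m}=\delta_{kl}u_{j,m}$ for all $j,k,l,m$ (Kronecker delta); (c) $x=\sum_{k=0}^{\infty}u_{k,k}x$ for every $x\in X$, with convergence in norm. An infinite-dimensional Banach space $X$ has uniform multiplicity infinity of infinite index if there is a system of matrix units $\{u_{j,k}\}_{j,k=0}^\infty$ of $\mathcal{B}(X)$ with $\dim\operatorname{Ran}u_{0,0}=\infty$. *)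

(* Defs.v *)
From HB Require Import structures.
From mathcomp Require Import all_boot all_order all_algebra.
From mathcomp Require Import complex.
From mathcomp Require Import all_classical all_reals all_analysis.

Set Implicit Arguments.
Unset Strict Implicit.
Unset Printing Implicit Defensive.

Import Order.TTheory GRing.Theory Num.Theory.
Import numFieldNormedType.Exports.

Local Open Scope classical_set_scope.
Local Open Scope ring_scope.
Local Open Scope complex_scope.

(* MathComp norms over the scalars R[i] take values in R[i]; they are real and
   nonnegative there, so that complex.Re loses no information. *)
Definition rnorm (R : realType) (V : normedZmodType R[i]) (x : V) : R :=
  complex.Re `|x|.

Section RnormTheory.
Variable R : realType.

Lemma rnormE (V : normedZmodType R[i]) (x : V) : `|x| = (rnorm x)%:C.
Proof. by rewrite /rnorm RRe_real// ger0_real. Qed.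

Lemma rnorm_ge0 (V : normedZmodType R[i]) (x : V) : 0 <= rnorm x.
Proof. by have := normr_ge0 x; rewrite rnormE ler0c. Qed.

Lemma rnormM (x y : R[i]) : rnorm (x * y) = rnorm x * rnorm y.
Proof. by apply: (@complexI R); rewrite rmorphM/= -!rnormE normrM. Qed.

Lemma rnormD (V : normedZmodType R[i]) (x y : V) :
  rnorm (x + y) <= rnorm x + rnorm y.
Proof. by rewrite -lecR rmorphD/= -!rnormE ler_normD. Qed.

Lemma rnorm0 (V : normedZmodType R[i]) : rnorm (0 : V) = 0.
Proof. by rewrite /rnorm normr0. Qed.

Lemma rnorm0_eq0 (V : normedZmodType R[i]) (x : V) : rnorm x = 0 -> x = 0.
Proof. by move=> h; apply/eqP; rewrite -normr_eq0 rnormE h. Qed.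

End RnormTheory.

Section Operators.
Variables (R : realType) (X : normedModType R[i]).

Definition banach : Prop :=
  forall F : set_system X, ProperFilter F -> cauchy F -> cvg F.

Definition fin_dim (V : set X) : Prop :=
  exists (n : nat) (b : 'I_n -> X),
    V = [set \sum_(i < n) c i *: b i | c in [set: 'I_n -> R[i]]].

(* The value +oo is taken exactly when f is not bounded. *)
Definition opnorm (f : {linear X -> X}) : \bar R :=
  ereal_sup [set (rnorm (f x))%:E | x in [set x : X | rnorm x <= 1]].

Definition bounded_operators : set {linear X -> X} :=
  [set f | (opnorm f < +oo)%E].

Record matrix_units (u : nat -> nat -> {linear X -> X}) : Prop := MatrixUnits {
  mu_bounded : forall j k, bounded_operators (u j k) ;
  mu_unif_bounded :
    (ereal_sup [set opnorm (u jk.1 jk.2) | jk in [set: nat * nat]] < +oo)%E ;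
  mu_mul : forall j k l m x,
    u j k (u l m x) = (k == l)%:R *: u j m x ;
  mu_sum : forall x, series (fun k => u k k x) @ \oo --> x
}.

(* For X a Banach space; completeness is not repeated here, see banach. *)
Definition uniform_multiplicity_infinity_of_infinite_index : Prop :=
  ~ fin_dim [set: X] /\
  exists u : nat -> nat -> {linear X -> X},
    matrix_units u /\ ~ fin_dim (range (u 0%N 0%N)).

End Operators.

Arguments banach {R} X.
Arguments uniform_multiplicity_infinity_of_infinite_index {R} X.

Section LpSequences.
Variables (R : realType) (p : R).
Implicit Types x y : nat -> R[i].

Definition lp_sum (x : nat -> R[i]) : \bar R :=
  (\sum_(0 <= n <oo) (rnorm (x n) `^ p)%:E)%E.

Definition lp_pred : {pred (nat -> R[i])} :=
  mem [set x | (lp_sum x < +oo)%E].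

Definition lp_norm (x : nat -> R[i]) : R := fine (lp_sum x) `^ p^-1.

End LpSequences.

Section LpTheory.
Variables (R : realType) (p : R).
Implicit Types (x y : nat -> R[i]) (f g : nat -> R).

Lemma lp_predP x : (x \in lp_pred p) <-> (lp_sum p x < +oo)%E.
Proof. by split => [/set_mem|/mem_set]. Qed.

Lemma lp_sum_ge0 x : (0 <= lp_sum p x)%E.
Proof. by apply: nneseries_ge0 => n _ _; rewrite lee_fin powR_ge0. Qed.

Lemma lp_sum_fin x : x \in lp_pred p -> lp_sum p x \is a fin_num.
Proof. by move=> /lp_predP h; rewrite ge0_fin_numE// lp_sum_ge0. Qed.

Lemma lp_sumE x : x \in lp_pred p -> lp_sum p x = (fine (lp_sum p x))%:E.
Proof. by move=> xp; rewrite fineK// lp_sum_fin. Qed.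

Lemma lp_term_le x n : ((rnorm (x n) `^ p)%:E <= lp_sum p x)%E.
Proof.
rewrite /lp_sum (@nneseriesD1 _ _ n)//; last first.
  by move=> k _; rewrite lee_fin powR_ge0.
by rewrite leeDl// nneseries_ge0// => k _ _; rewrite lee_fin powR_ge0.
Qed.

Lemma lp_norm_ge0 x : 0 <= lp_norm p x.
Proof. exact: powR_ge0. Qed.

Hypothesis p1 : 1 <= p.

Let p_gt0 : 0 < p. Proof. exact: lt_le_trans p1. Qed.

Let lsum f : \bar R := (\sum_(0 <= n <oo) (f n `^ p)%:E)%E.

Let lsum_ge0 f : (0 <= lsum f)%E.
Proof. by apply: nneseries_ge0 => n _ _; rewrite lee_fin powR_ge0. Qed.

Let Lnorm_lsum f : (forall n, 0 <= f n) ->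
  Lnorm (counting : {measure set nat -> \bar R}) p%:E (EFin \o f) =
  (lsum f `^ p^-1)%E.
Proof.
move=> f0; rewrite (@Lnorm_counting R p (EFin \o f) p_gt0).
congr (poweR _ _); apply: eq_eseriesr => n _.
by rewrite [abse _]/= (ger0_norm (f0 n)) poweR_EFin.
Qed.

Let lsumD f g : (forall n, 0 <= f n) -> (forall n, 0 <= g n) ->
  (lsum (fun n => f n + g n)%R `^ p^-1 <= lsum f `^ p^-1 + lsum g `^ p^-1)%E.
Proof.
move=> f0 g0; rewrite -(Lnorm_lsum f0) -(Lnorm_lsum g0) -Lnorm_lsum; last first.
  by move=> n; rewrite addr_ge0.
exact: (@minkowski_EFin _ _ R counting f g p).
Qed.

Let lp_sum_addr x y : lp_sum p (x + y) = lp_sum p (fun n => x n + y n).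
Proof. by []. Qed.

Let lp_sumD x y : (lp_sum p (x + y)%R `^ p^-1 <=
  lp_sum p x `^ p^-1 + lp_sum p y `^ p^-1)%E.
Proof.
rewrite lp_sum_addr.
apply: (le_trans _ (lsumD (fun n => rnorm_ge0 (x n)) (fun n => rnorm_ge0 (y n)))).
apply: gt0_ler_poweR.
- by rewrite invr_ge0 ltW.
- by rewrite in_itv/= lp_sum_ge0 leey.
- by rewrite in_itv/= lsum_ge0 leey.
apply: lee_nneseries => n _; first by rewrite lee_fin powR_ge0.
by rewrite lee_fin ge0_ler_powR ?nnegrE ?addr_ge0 ?rnorm_ge0 ?rnormD// ltW.
Qed.

Lemma lp_sumZ a x : lp_sum p (a *: x) = ((rnorm a `^ p)%:E * lp_sum p x)%E.
Proof.
rewrite /lp_sum -nneseriesZl//; last first.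
  by move=> n _; rewrite lee_fin powR_ge0.
apply: eq_eseriesr => n _; rewrite -EFinM; congr EFin.
by rewrite -powRM ?rnorm_ge0// -rnormM.
Qed.

Lemma lp_pred0 : 0 \in lp_pred p.
Proof.
apply/lp_predP; rewrite /lp_sum eseries0 ?ltry// => n _ _.
by rewrite rnorm0 powR0// gt_eqF.
Qed.

Lemma lp_predZ a x : x \in lp_pred p -> a *: x \in lp_pred p.
Proof.
by move=> xp; apply/lp_predP; rewrite lp_sumZ (lp_sumE xp) -EFinM ltry.
Qed.

Lemma lp_predD x y : x \in lp_pred p -> y \in lp_pred p -> x + y \in lp_pred p.
Proof.
move=> xp yp; apply/lp_predP; apply: (@lty_poweRy _ _ p^-1).
  by rewrite invr_neq0// gt_eqF.
apply: le_lt_trans (lp_sumD x y) _.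
by rewrite (lp_sumE xp) (lp_sumE yp) !poweR_EFin -EFinD ltry.
Qed.

Lemma lp_submod_closed : submod_closed (lp_pred p).
Proof.
split; first exact: lp_pred0.
by move=> a x y xp yp; apply: lp_predD yp; exact: lp_predZ.
Qed.

Lemma lp_normD x y : x \in lp_pred p -> y \in lp_pred p ->
  lp_norm p (x + y) <= lp_norm p x + lp_norm p y.
Proof.
move=> xp yp; have xyp := lp_predD xp yp.
have := lp_sumD x y.
by rewrite (lp_sumE xp) (lp_sumE yp) (lp_sumE xyp) !poweR_EFin -EFinD lee_fin.
Qed.

Lemma lp_normZ a x : x \in lp_pred p ->
  lp_norm p (a *: x) = rnorm a * lp_norm p x.
Proof.
move=> xp; rewrite /lp_norm lp_sumZ (lp_sumE xp) -EFinM.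
rewrite [fine _]/= [fine (_%:E)]/=.
rewrite powRM ?powR_ge0 ?fine_ge0 ?lp_sum_ge0//.
by rewrite -powRrM divff ?powRr1 ?rnorm_ge0// gt_eqF.
Qed.

Lemma lp_norm_eq0 x : x \in lp_pred p -> lp_norm p x = 0 -> x = 0.
Proof.
move=> xp /powR_eq0_eq0 s0; apply/funext => n; apply: rnorm0_eq0.
apply: (@powR_eq0_eq0 _ _ p); apply/eqP.
rewrite eq_le powR_ge0 andbT -lee_fin -s0 -(lp_sumE xp).
exact: lp_term_le.
Qed.

End LpTheory.

(* The argument p1 is only there to let the normed space instances, which need
   1 <= p, be found from the type. *)
Record lp (R : realType) (p : R) (p1 : 1 <= p) :=
  Lp { lp_seq :> nat -> R[i] ; lp_seqP : lp_seq \in lp_pred p }.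

Section LpSpace.
Variables (R : realType) (p : R) (p1 : 1 <= p).

HB.instance Definition _ := [isSub for @lp_seq R p p1].
HB.instance Definition _ := [Choice of lp p1 by <:].

HB.instance Definition _ := GRing.isSubmodClosed.Build R[i] (nat -> R[i])
  (lp_pred p) (lp_submod_closed p1).
HB.instance Definition _ := [SubChoice_isSubLmodule of lp p1 by <:].

Let norm (x : lp p1) : R[i] := (lp_norm p x)%:C.

Let norm_triangle x y : norm (x + y) <= norm x + norm y.
Proof.
by rewrite /norm -(rmorphD (real_complex R)) lecR lp_normD ?lp_seqP.
Qed.

Let normZ a x : norm (a *: x) = `|a| * norm x.
Proof.
rewrite /norm (rnormE a) -(rmorphM (real_complex R)).
by rewrite -lp_normZ ?lp_seqP.
Qed.

Let norm0_eq0 x : norm x = 0 -> x = 0.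
Proof.
by move=> /complexI/(lp_norm_eq0 (lp_seqP x)) x0; exact/val_inj.
Qed.

HB.instance Definition _ := Lmodule_isNormed.Build R[i] (lp p1)
  norm_triangle normZ norm0_eq0.

Lemma lp_normE (x : lp p1) : `|x| = (lp_norm p x)%:C.
Proof. by []. Qed.

End LpSpace.

(* Main.v *)
Require Import Defs.
From HB Require Import structures.
From mathcomp Require Import all_boot all_order all_algebra.
From mathcomp Require Import complex.
From mathcomp Require Import all_classical all_reals all_analysis.
From mathcomp Require Import ring.

(** Completeness is the usual coordinatewise argument. A Cauchy filter on l^p
    converges in every coordinate, because coordinates are bounded by the norm
    ([lp_norm_ge_coord]) and the complex numbers are complete
    ([complex_cauchy_limit]). Let l be the sequence of limits. If x is within e
    of almost all points y of the filter, then the truncation of x - l to its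
    first N entries is a truncation of x - y, of norm at most e, plus a
    truncation of y - l, of norm at most e once y is close to l in these N
    coordinates. This bound does not depend on N, so x - l is in l^p with norm
    at most 2e ([lp_sum_le_truncate]).

    The matrix units come from cutting the index set into infinitely many
    infinite rows by the 2-adic valuation: n lies in row k when
    n + 1 = 2 ^ k * m with m odd. Let u_(j,k) move the entries of row k to the
    entries of row j with the same odd part, and put 0 in the other rows. Every
    u_(j,k) pulls sequences back along an injection between sets of indices, so
    it does not increase the norm ([lp_sum_pullback]). The product rule holds
    index by index. The index n lies in a row numbered at most n, hence the
    difference between x and the sum of the u_(k,k) x for k < N vanishes below
    N, and its norm is bounded by that of a tail of x ([lp_tail_cvg0]).

    The range of u_(0,0) contains the unit vectors of all even indices, and a
    space that contains infinitely many unit vectors is not finitely generated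
    ([infinite_dim_units]). *)

Set Implicit Arguments.
Unset Strict Implicit.
Unset Printing Implicit Defensive.

Import Order.TTheory GRing.Theory Num.Theory.
Import numFieldNormedType.Exports.

Local Open Scope classical_set_scope.
Local Open Scope ring_scope.

(** * Convergence of complex numbers, by real and imaginary parts *)

Lemma rnormc_ge_Re (R : realType) (z : R[i]) : `|complex.Re z| <= rnorm z.
Proof. by rewrite -lecR -rnormE normc_ge_Re. Qed.

Lemma rnormc_ge_Im (R : realType) (z : R[i]) : `|complex.Im z| <= rnorm z.
Proof.
rewrite /rnorm normc_def /= -sqrtr_sqr ler_sqrt ?lerDr ?sqr_ge0//.
by rewrite addr_ge0 ?sqr_ge0.
Qed.

Lemma rnormc_le (R : realType) (z : R[i]) :
  rnorm z <= `|complex.Re z| + `|complex.Im z|.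
Proof.
rewrite /rnorm normc_def /= -[leRHS]ger0_norm ?addr_ge0//.
rewrite -sqrtr_sqr ler_sqrt ?sqr_ge0// sqrrD !real_normK ?num_real//.
by rewrite lerD2r lerDl mulrn_wge0// mulr_ge0.
Qed.

Lemma rnormN (R : realType) (V : normedZmodType R[i]) (x : V) :
  rnorm (- x) = rnorm x.
Proof. by rewrite /rnorm normrN. Qed.

(** Completeness of the complex numbers, for the real-valued modulus: the two
    real coordinates are 1-Lipschitz, so they converge in R, and together they
    bound the modulus. *)
Lemma complex_cauchy_limit (R : realType) (T : Type) (F : set_system T)
    (FF : ProperFilter F) (f : T -> R[i]) :
  (forall e : R, 0 < e -> exists z, \forall y \near F, rnorm (z - f y) < e) ->
  exists l, forall e : R, 0 < e -> \forall y \near F, rnorm (f y - l) < e.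
Proof.
move=> fC.
(* an additive map bounded by the modulus sends F to a Cauchy filter of R *)
have part_cvg (h : R[i] -> R) : (forall z w, h (z - w) = h z - h w) ->
    (forall z, `|h z| <= rnorm z) -> cvg (h (f y) @[y --> F]).
  move=> hB hle; apply: cauchy_cvg; apply: cauchy_exP => e e0.
  have [z zP] := fC _ e0; exists (h z).
  apply: filterS zP => y; rewrite -ball_normE /= -hB.
  exact: le_lt_trans.
have cRe := part_cvg (@complex.Re R) (raddfB (@complex.Re R)) (@rnormc_ge_Re R).
have cIm := part_cvg (@complex.Im R) (raddfB (@complex.Im R)) (@rnormc_ge_Im R).
exists (Complex (lim (complex.Re (f y) @[y --> F]))
                (lim (complex.Im (f y) @[y --> F]))) => e e0.
have e20 : 0 < e / 2 by rewrite divr_gt0.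
move: cRe cIm => /cvgrPdist_lt/(_ _ e20) cRe /cvgrPdist_lt/(_ _ e20) cIm.
near=> y; rewrite -rnormN opprB (le_lt_trans (rnormc_le _))//.
by rewrite !raddfB /= [e]splitr ltrD//; near: y.
Unshelve. all: by end_near. Qed.

(** * The size of a sequence *)

Section LpEstimates.
Variables (R : realType) (p : R) (p1 : 1 <= p).
Implicit Types (x : nat -> R[i]) (c : R).

Let p_gt0 : 0 < p. Proof. exact: lt_le_trans p1. Qed.

Let term_ge0 x n : (0 <= (rnorm (x n) `^ p)%:E)%E.
Proof. by rewrite lee_fin powR_ge0. Qed.

Lemma lp_norm_powR x :
  x \in lp_pred p -> ((lp_norm p x `^ p)%:E = lp_sum p x)%E.
Proof.
move=> xp; rewrite /lp_norm -powRrM mulVf ?gt_eqF// powRr1 -?lp_sumE//.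
by rewrite fine_ge0 ?lp_sum_ge0.
Qed.

Lemma lp_sum_le_powR x c : x \in lp_pred p -> lp_norm p x <= c ->
  (lp_sum p x <= (c `^ p)%:E)%E.
Proof.
move=> xp xc; have x0 := lp_norm_ge0 p x.
rewrite -lp_norm_powR// lee_fin ge0_ler_powR ?nnegrE ?(ltW p_gt0)//.
exact: le_trans xc.
Qed.

Lemma lp_norm_le x c : 0 <= c -> (lp_sum p x <= (c `^ p)%:E)%E ->
  x \in lp_pred p /\ lp_norm p x <= c.
Proof.
move=> c0 xc; have xp : x \in lp_pred p.
  by apply/lp_predP; apply: le_lt_trans xc _; rewrite ltry.
split=> //; move: xc; rewrite -lp_norm_powR// lee_fin leNgt => xc.
rewrite leNgt; apply: contra xc => cx.
by rewrite gt0_ltr_powR ?nnegrE// ?lp_norm_ge0.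
Qed.

Lemma lp_norm_ge_coord x n : x \in lp_pred p -> rnorm (x n) <= lp_norm p x.
Proof.
move=> xp; have := lp_term_le p x n.
rewrite -lp_norm_powR// lee_fin !leNgt; apply: contra => cx.
by rewrite gt0_ltr_powR ?nnegrE ?rnorm_ge0 ?lp_norm_ge0.
Qed.

Definition unit_seq (m n : nat) : R[i] := (n == m)%:R.

Lemma rnorm1 : rnorm (1 : R[i]) = 1 :> R.
Proof. by rewrite /rnorm normr1. Qed.

Lemma lp_sum_unit m : lp_sum p (unit_seq m) = 1%E.
Proof.
rewrite /lp_sum (@nneseriesD1 _ _ m)//.
rewrite /unit_seq eqxx rnorm1 powR1 eseries0 ?adde0// => k _ km.
by rewrite (negPf km) rnorm0 powR0 ?gt_eqF.
Qed.

Lemma unit_seq_lp m : unit_seq m \in lp_pred p.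
Proof. by apply/lp_predP; rewrite lp_sum_unit ltry. Qed.

Lemma lp_norm_unit m : lp_norm p (unit_seq m) = 1.
Proof. by rewrite /lp_norm lp_sum_unit /= powR1. Qed.

(** * Pulling a sequence back along a partial injection of the indices *)

(** Truncations, tails and matrix units are all of this form. *)
Definition pullback (A : pred nat) (s : nat -> nat) x : nat -> R[i] :=
  fun n => if A n then x (s n) else 0.

(** Injectivity makes the entries of the pullback a subfamily of those of x,
    so its sum is an unordered sum of the same terms over fewer indices. *)
Lemma lp_sum_pullback A s x : {in A &, injective s} ->
  (lp_sum p (pullback A s x) <= lp_sum p x)%E.
Proof.
move=> sI; pose a n := (rnorm (x n) `^ p)%:E.
have a0 n : (0 <= a n)%E by rewrite lee_fin powR_ge0.
have -> : lp_sum p (pullback A s x) = \esum_(n in [set n | A n]) a (s n).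
  rewrite esum_mkcond -nneseries_esumT; last by move=> n; case: ifP.
  apply: eq_eseriesr => n _; rewrite /pullback mem_setE.
  by rewrite /in_mem/=; case: ifP => //; rewrite rnorm0 powR0 ?gt_eqF.
rewrite -(@reindex_esum _ _ _ [set n | A n] (s @` [set n | A n]) s a); last first.
  by split=> // m n; rewrite !mem_setE; exact: sI.
rewrite /lp_sum nneseries_esumT// esum_mkcond.
by apply: le_esum => n _; case: ifP => _; [exact: lexx | exact: a0].
Qed.

Lemma pullback_lp A s x : {in A &, injective s} -> x \in lp_pred p ->
  pullback A s x \in lp_pred p.
Proof.
move=> sI /lp_predP xp; apply/lp_predP.
exact: le_lt_trans (lp_sum_pullback x sI) xp.
Qed.

Lemma lp_norm_pullback A s x : {in A &, injective s} -> x \in lp_pred p ->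
  lp_norm p (pullback A s x) <= lp_norm p x.
Proof.
move=> sI xp; apply: (lp_norm_le (lp_norm_ge0 p x) _).2.
by rewrite lp_norm_powR// lp_sum_pullback.
Qed.

Definition truncate N x := pullback (fun n => (n < N)%N) id x.

(** The triangle inequality applied to the expansion of the truncation in unit
    sequences. The sequence x itself is arbitrary: it will be the difference with
    a coordinatewise limit that is not yet known to be p-summable. *)
Lemma truncate_lp N x : truncate N x \in lp_pred p /\
  lp_norm p (truncate N x) <= \sum_(n < N) rnorm (x n).
Proof.
elim: N => [|N [xN xNle]].
  have -> : truncate 0 x = 0 by apply/funext.
  rewrite big_ord0 (lp_pred0 p1); split=> //.
  rewrite -(scale0r (unit_seq 0)) (lp_normZ p1) ?unit_seq_lp//.
  by rewrite rnorm0 mul0r.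
have -> : truncate N.+1 x = truncate N x + x N *: unit_seq N.
  apply/funext => n; rewrite /truncate /pullback /unit_seq.
  rewrite -[RHS]/((if (n < N)%N then x n else 0) + x N * (n == N)%:R).
  rewrite ltnS leq_eqVlt; case: eqVneq => [->|_] /=.
    by rewrite ltnn add0r mulr1.
  by rewrite mulr0 addr0.
have uN := lp_predZ (x N) (unit_seq_lp N).
split; first exact: lp_predD.
rewrite big_ord_recr (le_trans (lp_normD p1 xN uN))// lerD//.
by rewrite (lp_normZ p1) ?unit_seq_lp// lp_norm_unit mulr1.
Qed.

Lemma lp_sum_le_truncate x (c : \bar R) :
  (forall N, (lp_sum p (truncate N x) <= c)%E) -> (lp_sum p x <= c)%E.
Proof.
move=> xc; apply: lime_le.
  by apply: is_cvg_nneseries => n _ _; exact: term_ge0.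
apply: nearW => N; apply: le_trans (xc N).
apply: le_trans (nneseries_lim_ge N (fun n _ _ => term_ge0 (truncate N x) n)).
rewrite le_eqVlt; apply/orP; left; apply/eqP; apply: eq_big_nat => n /andP[_ nN].
by rewrite /truncate /pullback nN.
Qed.

Lemma lp_tail_cvg0 x e : x \in lp_pred p -> 0 < e ->
  \forall N \near \oo,
    lp_norm p (pullback (fun n => (N <= n)%N) id x) <= e.
Proof.
move=> /lp_predP xp e0.
have := nneseries_tail_cvg xp (fun n _ => term_ge0 x n).
move=> /(_ [set a | a < (e `^ p)%:E]%E) [].
  by apply: open_nbhs_nbhs; split;
    [exact: open_ereal_lt_ereal | rewrite /= lte_fin powR_gt0].
move=> N0 _ N0P; exists N0 => //= N /N0P/= /ltW xN.
apply: (lp_norm_le (ltW e0) _).2; apply: le_trans xN.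
have t1 := term_ge0 (pullback (fun n => (N <= n)%N) id x).
rewrite /lp_sum (nneseries_split 0 N) => [|n _]; last exact: t1.
rewrite add0n big_nat big1 ?add0e => [|n /andP[_ nN]]; last first.
  by rewrite /pullback leqNgt nN rnorm0 powR0 ?gt_eqF.
apply: lee_nneseries => n nN; first by move=> _; exact: term_ge0.
rewrite /pullback; case: ifP => _; [exact: lexx | rewrite rnorm0 powR0 ?gt_eqF//].
Qed.

End LpEstimates.

(** * Completeness *)

Lemma lp_rnormE (R : realType) (p : R) (p1 : 1 <= p) (x : lp p1) :
  rnorm x = lp_norm p x.
Proof. by rewrite /rnorm lp_normE. Qed.

(** A positive element of R[i] is real, so real radii suffice. *)
Lemma cvg_rnorm_le (R : realType) (V : normedModType R[i]) (T : Type)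
    (F : set_system T) (FF : Filter F) (f : T -> V) (v : V) :
  (forall e : R, 0 < e -> \forall t \near F, rnorm (v - f t) <= e) ->
  f t @[t --> F] --> v.
Proof.
move=> fv; apply/cvgrPdist_le => e e0.
have eE : e = (complex.Re e)%:C%C by rewrite RRe_real// gtr0_real.
have := fv (complex.Re e); rewrite -ltcR -eE => /(_ e0).
by apply: filterS => t; rewrite rnormE eE lecR.
Qed.

Lemma banach_lp (R : realType) (p : R) (p1 : 1 <= p) : banach (lp p1).
Proof.
move=> F FF /cauchyP Fc.
have {}Fc (e : R) : 0 < e ->
    exists x : lp p1, \forall y \near F, lp_norm p (lp_seq x - lp_seq y) < e.
  move=> e0; have [|x xF] := Fc e%:C%C; first by rewrite (ltcR 0).
  exists x; apply: filterS xF => y.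
  by rewrite -ball_normE /= rnormE lp_rnormE ltcR.
have /choice[l lP] : forall n, exists ln : R[i], forall e : R, 0 < e ->
    \forall y \near F, rnorm (lp_seq y n - ln) < e.
  move=> n; apply: complex_cauchy_limit => e /Fc[x xF]; exists (lp_seq x n).
  apply: filterS xF => y; apply: le_lt_trans.
  exact: (@lp_norm_ge_coord _ _ p1 _ n (lp_seqP (x - y))).
have close N (e : R) : 0 < e ->
    \forall y \near F, \sum_(n < N) rnorm (lp_seq y n - l n) <= e.
  elim: N e => [|N IH] e e0.
    by apply: nearW => y; rewrite big_ord0 ltW.
  have e20 : 0 < e / 2 by rewrite divr_gt0.
  near=> y; rewrite big_ord_recr /= [leRHS]splitr lerD//; near: y.
    exact: IH.
  by apply: filterS (lP N _ e20) => y /ltW.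
(* bound each truncation at N by a y chosen for that N; the bound is uniform *)
have lim_close (e : R) (x : lp p1) : 0 < e ->
    (\forall y \near F, lp_norm p (lp_seq x - lp_seq y) < e) ->
    lp_seq x - l \in lp_pred p /\ lp_norm p (lp_seq x - l) <= e + e.
  move=> e0 xF; apply: (lp_norm_le p1); first by rewrite addr_ge0 ?ltW.
  apply: lp_sum_le_truncate => N.
  have [y [/ltW xy yl]] : exists y : lp p1,
      lp_norm p (lp_seq x - lp_seq y) < e /\
      \sum_(n < N) rnorm (lp_seq y n - l n) <= e.
    by apply: filter_ex (filterI xF (close N e e0)).
  have sI : {in (fun n => n < N)%N &, injective (@id nat)} by [].
  have xyp : lp_seq x - lp_seq y \in lp_pred p := lp_seqP (x - y).
  have -> : truncate N (lp_seq x - l) =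
      truncate N (lp_seq x - lp_seq y) + truncate N (lp_seq y - l).
    apply/funext => n; rewrite /truncate /pullback.
    rewrite -[RHS]/((if (n < N)%N then lp_seq x n - lp_seq y n else 0) +
                   (if (n < N)%N then lp_seq y n - l n else 0)).
    by case: ifP => _; rewrite ?addr0// addrA subrK.
  have [ylp ylle] := truncate_lp p1 N (lp_seq y - l).
  have tp := pullback_lp p1 sI xyp.
  apply: (lp_sum_le_powR p1); first exact: lp_predD.
  apply: le_trans (lp_normD p1 tp ylp) _; apply: lerD.
    exact: le_trans (lp_norm_pullback p1 sI xyp) xy.
  exact: le_trans ylle yl.
have lp_l : l \in lp_pred p.
  have [x xF] := Fc 1 ltr01; have [xl _] := lim_close _ _ ltr01 xF.
  have -> : l = lp_seq x + (-1) *: (lp_seq x - l).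
    by rewrite scaleN1r opprB addrC subrK.
  by rewrite lp_predD ?lp_predZ ?lp_seqP.
apply/cvg_ex; exists (Lp p1 lp_l); rewrite -[F]/(y @[y --> F]).
apply: cvg_rnorm_le => e e0; have e30 : 0 < e / 3 by rewrite divr_gt0.
have [x xF] := Fc _ e30; have [_ xl] := lim_close _ _ e30 xF.
apply: filterS xF => y /ltW xy.
rewrite -(subrKA x) (le_trans (rnormD _ _))//.
rewrite -[X in rnorm X + _]opprB rnormN !lp_rnormE.
have -> : e = (e / 3 + e / 3) + e / 3 by field.
exact: lerD.
Unshelve. all: by end_near. Qed.

(** * Spans *)

Lemma lp_seq_sum (R : realType) (p : R) (p1 : 1 <= p) n
    (c : 'I_n -> R[i]) (b : 'I_n -> lp p1) m :
  lp_seq (\sum_(i < n) c i *: b i) m = \sum_(i < n) c i * lp_seq (b i) m.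
Proof. exact: (big_morph (fun x : lp p1 => lp_seq x m)). Qed.

Definition lp_unit (R : realType) (p : R) (p1 : 1 <= p) (n : nat) : lp p1 :=
  Lp p1 (unit_seq_lp p1 n).

(** With n generators b_j, the n + 1 coordinates at f 0, ..., f n form an
    (n + 1) x n matrix, which has a nonzero row v in its left kernel. The
    coordinates at f 0, ..., f n of every element of the span then satisfy the
    linear relation v, but the unit vector at f i forces v_i = 0. *)
Lemma infinite_dim_units (R : realType) (p : R) (p1 : 1 <= p)
    (V : set (lp p1)) (f : nat -> nat) :
  injective f -> (forall i, V (lp_unit p1 (f i))) -> ~ fin_dim V.
Proof.
move=> fI fV [n [b Vb]].
pose B := \matrix_(i < n.+1, j < n) lp_seq (b j) (f i).
have /rowV0Pn [v /sub_kermxP vB v0] : kermx B != 0.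
  rewrite kermx_eq0 /row_free neq_ltn; apply/orP; left.
  by rewrite ltnS rank_leq_col.
suff : v = 0 by move/eqP; rewrite (negPf v0).
apply/rowP => i; rewrite mxE.
have := fV i; rewrite Vb => -[c _ cE].
transitivity (\sum_(k < n.+1) v 0 k * lp_seq (lp_unit p1 (f i)) (f k)).
  rewrite (bigD1 i)//= /unit_seq eqxx mulr1 big1 ?addr0// => k ki.
  by rewrite (inj_eq fI) (inj_eq val_inj) (negPf ki) mulr0.
rewrite -cE; under eq_bigr do rewrite lp_seq_sum mulr_sumr.
rewrite exchange_big big1 //= => j _.
have /rowP/(_ j) := vB; rewrite !mxE => vBj.
transitivity (c j * \sum_k v 0 k * B k j); last by rewrite vBj mulr0.
by rewrite mulr_sumr; apply: eq_bigr => k _; rewrite mxE mulrCA.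
Qed.

(** * Rows of indices, by the 2-adic valuation *)

Definition dyadic_row (n : nat) : nat := logn 2 n.+1.

(** The index of row k that has the same odd part as n; indices are shifted by
    one because 0 has no odd part. *)
Definition dyadic_slot (k n : nat) : nat := (n.+1`_2^' * 2 ^ k)%N.-1.

Lemma dyadic_slotS k n : (dyadic_slot k n).+1 = (n.+1`_2^' * 2 ^ k)%N.
Proof. by rewrite /dyadic_slot prednK// muln_gt0 part_gt0 expn_gt0. Qed.

Lemma dyadic_row_slot k n : dyadic_row (dyadic_slot k n) = k.
Proof.
rewrite /dyadic_row dyadic_slotS lognM ?part_gt0 ?expn_gt0// pfactorK//.
by rewrite logn_coprime// (@pnat_coprime 2%N)// part_pnat.
Qed.

Lemma dyadic_slot_slot k l n : dyadic_slot l (dyadic_slot k n) = dyadic_slot l n.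
Proof.
rewrite [LHS]/dyadic_slot dyadic_slotS /dyadic_slot partnM ?part_gt0 ?expn_gt0//.
by rewrite partn_part// (@part_p'nat _ (2 ^ k)%N) ?muln1// pnatNK pnatX pnat_id.
Qed.

Lemma dyadic_slot_dyadic_row n : dyadic_slot (dyadic_row n) n = n.
Proof.
by apply: succn_inj; rewrite dyadic_slotS mulnC /dyadic_row -p_part partnC.
Qed.

Lemma dyadic_row_le n : (dyadic_row n <= n)%N.
Proof. by rewrite -ltnS ltn_logl. Qed.

(** On row j, moving back from row k to row j inverts the move. *)
Lemma dyadic_slot_inj k j :
  {in (fun n => dyadic_row n == j) &, injective (dyadic_slot k)}.
Proof.
move=> m n /eqP mj /eqP nj mn.
rewrite -(dyadic_slot_dyadic_row m) mj -(dyadic_slot_slot k) mn.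
by rewrite dyadic_slot_slot -nj dyadic_slot_dyadic_row.
Qed.

(** * Matrix units *)

Section PullbackOperator.
Variables (R : realType) (p : R) (p1 : 1 <= p).
Variables (A : pred nat) (s : nat -> nat) (sI : {in A &, injective s}).

Definition lp_pullback (x : lp p1) : lp p1 :=
  Lp p1 (pullback_lp p1 sI (lp_seqP x)).

Lemma lp_pullback_linear : linear lp_pullback.
Proof.
move=> a x y; apply/val_inj/funext => n /=; rewrite /pullback.
rewrite -[RHS]/(a * (if A n then x (s n) else 0) + (if A n then y (s n) else 0)).
by case: ifP => // _; rewrite mulr0 addr0.
Qed.

HB.instance Definition _ :=
  GRing.isLinear.Build R[i] (lp p1) (lp p1) *:%R lp_pullback lp_pullback_linear.

Lemma opnorm_pullback : (opnorm lp_pullback <= 1)%E.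
Proof.
apply: ge_ereal_sup => _ [x x1 <-]; rewrite lee_fin.
apply: le_trans x1; rewrite (lp_rnormE x) (lp_rnormE (lp_pullback x)).
exact: lp_norm_pullback (lp_seqP x).
Qed.

End PullbackOperator.

Definition munit (R : realType) (p : R) (p1 : 1 <= p) (j k : nat) :
  {linear lp p1 -> lp p1} :=
  @lp_pullback R p p1 _ _ (@dyadic_slot_inj k j).

Lemma matrix_units_munit (R : realType) (p : R) (p1 : 1 <= p) :
  matrix_units (munit p1).
Proof.
split.
- move=> j k; apply: le_lt_trans (opnorm_pullback _ _) _; exact: ltry.
- apply: (@le_lt_trans _ _ 1%E); last exact: ltry.
  by apply: ge_ereal_sup => _ [jk _ <-]; exact: opnorm_pullback.
- move=> j k l m x; apply/val_inj/funext => n.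
  rewrite -[RHS]/((k == l)%:R * munit p1 j m x n) /= /pullback.
  rewrite /= dyadic_row_slot dyadic_slot_slot.
  case: ifP => _; last by rewrite mulr0.
  by case: eqP; rewrite ?mul1r ?mul0r.
- move=> x; apply: cvg_rnorm_le => e e0.
  apply: filterS (lp_tail_cvg0 p1 (lp_seqP x) e0) => N; apply: le_trans.
  (* the partial sum keeps rows below N, so its distance to x lies in the tail *)
  have seriesE n : lp_seq (series (fun k => munit p1 k k x) N) n =
      if (dyadic_row n < N)%N then x n else 0.
    rewrite /series /=; elim: N => [|N IH]; first by rewrite big_nil.
    rewrite big_nat_recr //= -[LHS]/(_ + munit p1 N N x n) IH /= /pullback.
    rewrite [in RHS]ltnS [in RHS]leq_eqVlt.
    case: eqVneq => [<-|_] /=; last by rewrite addr0.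
    by rewrite ltnn add0r dyadic_slot_dyadic_row.
  rewrite lp_rnormE.
  have -> : lp_seq (x - series (fun k => munit p1 k k x) N) =
      pullback (fun n => N <= dyadic_row n)%N id
        (pullback (fun n => N <= n)%N id x).
    apply/funext => n; rewrite -[LHS]/(x n - lp_seq (series _ N) n) seriesE.
    rewrite /pullback; case: (ltnP (dyadic_row n)) => [_|Nn]; first by rewrite subrr.
    by rewrite (leq_trans Nn (dyadic_row_le n)) subr0.
  by apply: lp_norm_pullback => //; apply: pullback_lp => //; exact: lp_seqP.
Qed.

Lemma munit00_unit (R : realType) (p : R) (p1 : 1 <= p) i :
  range (munit p1 0 0) (lp_unit p1 i.*2).
Proof.
have ri : dyadic_row i.*2 = 0%N.
  by rewrite /dyadic_row logn_coprime// coprime2n /= odd_double.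
exists (lp_unit p1 i.*2) => //; apply/val_inj/funext => n /=; rewrite /pullback.
rewrite /unit_seq; case: eqP => [<-|n0]; first by rewrite dyadic_slot_dyadic_row.
by case: eqP => // ni; case: n0; rewrite ni.
Qed.

Theorem proposition3p5 (R : realType) (p : R) (p1 : 1 <= p) :
  banach (lp p1) /\ uniform_multiplicity_infinity_of_infinite_index (lp p1).
Proof.
split; first exact: banach_lp.
split; first exact: (@infinite_dim_units _ _ _ _ id).
exists (munit p1); split; first exact: matrix_units_munit.
exact: (infinite_dim_units double_inj (munit00_unit p1)).
Qed.
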